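(* For integers $k,n\ge0$ let $A_k(n)$ be the number of $k$-arrangements of $[n]$. Then: 1. $A_k(0)=1$ and, for $n>0$, $A_k(n)=n\,A_k(n-1)+(k-1)^n$. 2. $\displaystyle\sum_{n\ge0}A_k(n)\frac{x^n}{n!}=\frac{e^{(k-1)x}}{1-x}$. 3. $A_k(n)$ equals the permanent of the $n\times n$ matrix with $k$ on the diagonal and $1$s elsewhere. 4. For $k\ge1$, the sequence $(A_k(n))_{n\ge0}$ is the binomial transform of $(A_{k-1}(n))_{n\ge0}$, that is, $A_k(n)=\sum_{i\ge0}\binom{n}{i}A_{k-1}(i)$.
   Context: $[n]=\{1,\dots,n\}$. For $k\ge1$, a $k$-arrangement of $[n]$ is a pair $(\pi,\phi)$ where $\pi$ is a permutation of $[n]$ and $\phi:\mathsf{Fix}(\pi)\to[k]$ is an arbitrary map from the set of fixed points of $\pi$ to $[k]$. A $0$-arrangement of $[n]$ is a derangement of $[n]$ (a permutation with no fixed points). For $n=0$ there is exactly one $k$-arrangement, for every $k\ge0$. *)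

(* Defs.v *)
(* MathComp; boolp is used for function extensionality and to equip the type
   of formal power series with equality and choice. *)
From HB Require Import structures.
From mathcomp Require Import all_boot all_order all_algebra all_fingroup.
From mathcomp Require boolp.

Set Implicit Arguments.
Unset Strict Implicit.
Unset Printing Implicit Defensive.

Import GRing.Theory.
Local Open Scope ring_scope.

(** * Arrangements *)

(* [n] is rendered as 'I_n = {0, ..., n-1}, and the colour set [k] as 'I_k. *)

Definition fixed_point (n : nat) (s : 'S_n) : Type := {x : 'I_n | s x == x}.

HB.instance Definition _ (n : nat) (s : 'S_n) := Finite.on (fixed_point s).

Definition derangement (n : nat) : Type :=
  {s : 'S_n | [forall x, s x != x]}.

HB.instance Definition _ (n : nat) := Finite.on (derangement n).

Definition coloured_perm (k n : nat) : Type :=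
  {s : 'S_n & {ffun fixed_point s -> 'I_k}}.

HB.instance Definition _ (k n : nat) := Finite.on (coloured_perm k n).

Definition arrangement (k n : nat) : finType :=
  if k is 0 then derangement n else coloured_perm k n.

Definition num_arrangements (k n : nat) : nat := #|arrangement k n|.

(** * Permanents *)

Definition permanent (R : pzSemiRingType) (n : nat) (A : 'M[R]_n) : R :=
  \sum_(s : 'S_n) \prod_(i < n) A i (s i).

(** * Formal power series in one variable *)

Record fps (R : Type) : Type := FPS { fps_coef : nat -> R }.

Lemma fpsP (R : Type) (f g : fps R) : fps_coef f =1 fps_coef g <-> f = g.
Proof.
by split=> [|->//]; case: f g => [f] [g] /= fg; congr FPS; apply: boolp.funext.
Qed.

HB.instance Definition _ (R : Type) := boolp.gen_eqMixin (fps R).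
HB.instance Definition _ (R : Type) := boolp.gen_choiceMixin (fps R).

Section FpsZmodule.
Variable R : zmodType.
Implicit Types f g h : fps R.

Definition fps_zero : fps R := FPS (fun=> 0).
Definition fps_opp f := FPS (fun n => - fps_coef f n).
Definition fps_add f g := FPS (fun n => fps_coef f n + fps_coef g n).

Fact fps_addA : associative fps_add.
Proof. by move=> f g h; apply/fpsP => n /=; rewrite addrA. Qed.
Fact fps_addC : commutative fps_add.
Proof. by move=> f g; apply/fpsP => n /=; rewrite addrC. Qed.
Fact fps_add0 : left_id fps_zero fps_add.
Proof. by move=> f; apply/fpsP => n /=; rewrite add0r. Qed.
Fact fps_addN : left_inverse fps_zero fps_opp fps_add.
Proof. by move=> f; apply/fpsP => n /=; rewrite addNr. Qed.

HB.instance Definition _ :=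
  GRing.isZmodule.Build (fps R) fps_addA fps_addC fps_add0 fps_addN.

End FpsZmodule.

Section FpsComRing.
Variable R : comNzRingType.
Implicit Types f g h : fps R.

Definition fps_one : fps R := FPS (fun n => (n == 0%N)%:R).
Definition fps_mul f g :=
  FPS (fun n => \sum_(i < n.+1) fps_coef f i * fps_coef g (n - i)%N).

Definition fps_trunc (m : nat) f : {poly R} := \poly_(i < m) fps_coef f i.

Fact fps_mul_trunc (m n : nat) f g : (n < m)%N ->
  fps_coef (fps_mul f g) n = (fps_trunc m f * fps_trunc m g)`_n.
Proof.
move=> nm; rewrite coefM /=; apply: eq_bigr => i _.
by rewrite !coef_poly (leq_ltn_trans _ nm) ?(leq_ltn_trans _ nm)
           ?leq_subr // -ltnS.
Qed.

Fact fps_mulC : commutative fps_mul.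
Proof.
by move=> f g; apply/fpsP => n; rewrite !(@fps_mul_trunc n.+1) // mulrC.
Qed.

Fact fps_mulA : associative fps_mul.
Proof.
move=> f g h; apply/fpsP => n.
transitivity (fps_trunc n.+1 f * fps_trunc n.+1 g * fps_trunc n.+1 h)`_n.
  rewrite -mulrA coefM; apply: eq_bigr => i _; rewrite coef_poly ltn_ord.
  by rewrite -fps_mul_trunc // ltnS leq_subr.
rewrite coefM; apply: eq_bigr => i _; rewrite coef_poly ltnS leq_subr.
by rewrite -fps_mul_trunc.
Qed.

Fact fps_mul1 : left_id fps_one fps_mul.
Proof.
move=> f; apply/fpsP => n /=; rewrite big_ord_recl /= mul1r subn0 big1 ?addr0 //.
by move=> i _; rewrite mul0r.
Qed.

Fact fps_mulDl : left_distributive fps_mul (@fps_add R).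
Proof.
move=> f g h; apply/fpsP => n /=; rewrite -big_split /=.
by apply: eq_bigr => i _; rewrite mulrDl.
Qed.

Fact fps_one_neq0 : fps_one != 0.
Proof.
by apply/eqP => /fpsP/(_ 0%N)/eqP; rewrite /= oner_eq0.
Qed.

HB.instance Definition _ := GRing.Zmodule_isComNzRing.Build (fps R)
  fps_mulA fps_mulC fps_mul1 fps_mulDl fps_one_neq0.

Definition fpsX : fps R := FPS (fun n => (n == 1%N)%:R).

End FpsComRing.

Arguments fpsX {R}.

Section FpsUnit.
Variable R : comUnitRingType.
Implicit Types f g : fps R.

Definition fps_unit : {pred fps R} :=
  fun f => fps_coef f 0 \is a GRing.unit.

(* The first m coefficients of the inverse of f, obtained by solving
   \sum_(i <= n) f_(n-i) b_i = (n == 0) successively for b_n. *)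
Fixpoint fps_inv_seq f (m : nat) : seq R :=
  if m is n.+1 then
    let b := fps_inv_seq f n in
    rcons b ((fps_coef f 0)^-1 *
             ((n == 0%N)%:R - \sum_(i < n) fps_coef f (n - i)%N * b`_i))
  else [::].

Definition fps_inv f :=
  if f \in fps_unit then FPS (fun n => (fps_inv_seq f n.+1)`_n) else f.

Fact size_fps_inv_seq f m : size (fps_inv_seq f m) = m.
Proof. by elim: m => //= m IH; rewrite size_rcons IH. Qed.

Fact nth_fps_inv_seq f m i : (i < m)%N ->
  (fps_inv_seq f m)`_i = (fps_inv_seq f i.+1)`_i.
Proof.
elim: m => // m IH; rewrite ltnS leq_eqVlt => /predU1P[-> //|im].
by rewrite [in LHS]/= nth_rcons size_fps_inv_seq im IH.
Qed.

Fact fps_mulVx : {in fps_unit, left_inverse 1 fps_inv *%R}.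
Proof.
move=> f fU; rewrite /fps_inv fU; apply/fpsP => n.
rewrite [LHS]/= big_ord_recr subnn -[RHS]/((n == 0%N)%:R).
rewrite (_ : \sum_(i < n) _ =
  \sum_(i < n) fps_coef f (n - i)%N * (fps_inv_seq f n)`_i); last first.
  by apply: eq_bigr => i _; rewrite -[rcons _ _]/(fps_inv_seq f i.+1)
     (nth_fps_inv_seq f (ltn_ord i)) mulrC.
rewrite /= nth_rcons size_fps_inv_seq ltnn eqxx mulrAC mulVr // mul1r.
by rewrite addrC subrK.
Qed.

Fact fps_unitPl f g : g * f = 1 -> fps_unit f.
Proof.
move=> /fpsP/(_ 0%N); rewrite /= big_ord_recl big_ord0 addr0 /= => gf1.
by apply/unitrPr; exists (fps_coef g 0); rewrite mulrC.
Qed.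

Fact fps_invr_out : {in [predC fps_unit], fps_inv =1 id}.
Proof. by move=> f; rewrite inE /= /fps_inv => /negPf->. Qed.

HB.instance Definition _ := GRing.ComNzRing_hasMulInverse.Build (fps R)
  fps_mulVx fps_unitPl fps_invr_out.

End FpsUnit.

(* Exponential generating function \sum_n (a n) x^n / n!. *)
Definition egf (a : nat -> rat) : fps rat := FPS (fun n => a n / n`!%:R).

(* The formal series e^(c x) = \sum_n (c x)^n / n!. *)
Definition fps_exp (c : rat) : fps rat := FPS (fun n => c ^+ n / n`!%:R).

(* Main.v *)
(** A [k]-arrangement is a permutation [s] weighted by [k ^ #fix s], whence the
    permanent.  Writing each diagonal factor [k] as [(k - 1) + 1] and expanding
    selects a set [J] of fixed points with weight [(k - 1) ^ #|J|]; there are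
    [(n - #|J|)!] permutations fixing [J] pointwise, so that
    [A_k(n) = \sum_j n! / j! * (k - 1) ^ j].  This gives the recurrence, which
    is the generating function identity multiplied by [1 - x] and which also
    the binomial transform of [A_(k-1)] satisfies. *)
Require Import Defs.
From HB Require Import structures.
From mathcomp Require Import all_boot all_order all_algebra all_fingroup.

Import GRing.Theory.
Local Open Scope ring_scope.

(** The case [k = 0] fits the same formula because [0 ^ m] is 1 for [m = 0] and 0 otherwise, so that
    only derangements contribute. *)
Lemma num_arrangementsE (k n : nat) :
  num_arrangements k n = (\sum_(s : 'S_n) k ^ #|[pred i | s i == i]|)%N.
Proof.
rewrite /num_arrangements; case: k => [|k] /=.
  rewrite card_sig -sum1_card big_mkcond; apply: eq_bigr => s _.
  have -> : (s \in [pred s : 'S_n | [forall x, s x != x]]) =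
            (#|[pred i | s i == i]| == 0)%N.
    apply/forallP/pred0P => noFix i; first exact: negPf (noFix i).
    by rewrite [_ == _]noFix.
  by case: #|[pred i | s i == i]| => // m; rewrite exp0n.
rewrite card_tagged sumnE big_map big_enum; apply: eq_bigr => s _.
by rewrite card_ffun card_ord card_sig.
Qed.

Lemma sum_powerset_card (R : nmodType) (I : finType) (F : nat -> R) :
  \sum_(J : {set I}) F #|J| = \sum_(j < #|I|.+1) F j *+ 'C(#|I|, j).
Proof.
rewrite (partition_big (fun J : {set I} => inord #|J| : 'I_#|I|.+1) xpredT) //=.
apply: eq_bigr => j _; rewrite -card_draws -sumr_const.
have cardJ (J : {set I}) : (inord #|J| == j) = (#|J| == j).
  by rewrite -val_eqE /= inordK // ltnS max_card.
by apply: eq_big => J; rewrite ?inE cardJ // => /eqP->.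
Qed.

(** The coefficient [n ^_ (n - j)] is n!/j! written without division; it arises as ['C(n, j)]
    choices of [J] times (n - j)! permutations. *)
Lemma permanent_const_diag (R : comNzRingType) (n : nat) (c : R) :
  permanent (\matrix_(i < n, j < n) (if i == j then c + 1 else 1)) =
  \sum_(j < n.+1) (n ^_ (n - j))%:R * c ^+ j.
Proof.
transitivity (\sum_(J : {set 'I_n}) (n - #|J|)`!%:R * c ^+ #|J|); last first.
  rewrite (sum_powerset_card _ _ (fun j => (n - j)`!%:R * c ^+ j)) card_ord.
  apply: eq_bigr => j _; have jn : (j <= n)%N by rewrite -ltnS.
  by rewrite -mulrnAl -mulrnA mulnC -(bin_sub jn) bin_ffact.
(* Each factor of the permanent is [F s i + 1]; the term of [J] in the expanded product vanishes
   unless [s] fixes [J] pointwise. *)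
pose F (s : 'S_n) i : R := if s i == i then c else 0.
transitivity (\sum_(s : 'S_n) \sum_(J : {set 'I_n})
                \prod_i (if i \in J then F s i else 1)).
  apply: eq_bigr => s _; rewrite -bigA_distr; apply: eq_bigr => i _.
  by rewrite mxE (eq_sym i) /F /=; case: ifP; rewrite ?add0r.
rewrite exchange_big; apply: eq_bigr => J _ /=.
(* Fixing [J] pointwise means being supported on [~: J], so the factorial becomes the cardinality of
   [perm_on (~: J)]. *)
rewrite -[n in (n - _)%N]card_ord -(cardsC J) addKn -card_perm.
rewrite -sum1_card natr_sum mulr_suml [RHS]big_mkcond /=.
apply: eq_bigr => s _; rewrite -[LHS]big_mkcond /=.
rewrite [_ \in _](_ : _ = [forall (i | i \in J), s i == i]); last first.
  apply/subsetP/forall_inP => [fixJ i iJ|fixJ i].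
    by apply/negPn/negP => /fixJ; rewrite inE iJ.
  by rewrite !inE; apply: contra => /fixJ.
case: ifPn => [/forall_inP fixJ|].
  by rewrite mul1r -prodr_const; apply: eq_bigr => i /fixJ; rewrite /F => ->.
rewrite negb_forall => /existsP[i]; rewrite negb_imply => /andP[iJ /negPf sii].
by rewrite (bigD1 i) //= /F sii mul0r.
Qed.

Lemma num_arrangements_permanent (k n : nat) :
  (num_arrangements k n)%:Z =
  permanent (\matrix_(i < n, j < n) (if i == j then k%:Z else 1)).
Proof.
rewrite num_arrangementsE -natz natr_sum; apply: eq_bigr => s _.
rewrite natrX natz -prodr_const big_mkcond.
by apply: eq_bigr => i _; rewrite mxE inE eq_sym.
Qed.

(** Integers are used since [k - 1] is -1 for [k = 0], where this is the classical formula for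
    derangements. *)
Lemma num_arrangements_sum (k n : nat) :
  (num_arrangements k n)%:Z =
  \sum_(j < n.+1) (n ^_ (n - j))%:R * (k%:Z - 1) ^+ j.
Proof.
by rewrite num_arrangements_permanent -permanent_const_diag subrK.
Qed.

Lemma num_arrangements0 (k : nat) : num_arrangements k 0 = 1%N.
Proof.
by have := num_arrangements_sum k 0; rewrite big_ord1 mulr1 => -[].
Qed.

(** The last term of the sum is the power of [k - 1]; each other one yields a factor [n.+1] from its
    falling factorial. *)
Lemma num_arrangementsS (k n : nat) :
  (num_arrangements k n.+1)%:Z =
  n.+1%:Z * (num_arrangements k n)%:Z + (k%:Z - 1) ^+ n.+1.
Proof.
rewrite !num_arrangements_sum big_ord_recr /= subnn mul1r; congr (_ + _).
rewrite mulr_sumr; apply: eq_bigr => j _.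
by rewrite subSn -1?ltnS // ffactSS natrM natz mulrA.
Qed.

Lemma egf_num_arrangements (k : nat) :
  egf (fun n => (num_arrangements k n)%:R) = fps_exp (k%:R - 1) / (1 - fpsX).
Proof.
(* Invertibility only concerns the constant coefficient, here 1, and is decided by computation. *)
have U : (1 - fpsX : fps rat) \is a GRing.unit by [].
apply: (canRL (mulrK U)); rewrite mulrBr mulr1.
have mulX (f : fps rat) n : fps_coef (f * fpsX) n.+1 = fps_coef f n.
  rewrite mulrC /= 2!big_ord_recl /= mul0r add0r mul1r subSS subn0.
  by rewrite big1 ?addr0 // => i _; rewrite mul0r.
apply/fpsP => -[|n].
  by rewrite /= big_ord1 mulr0 subr0 num_arrangements0.
have aS : (num_arrangements k n.+1)%:R =
    n.+1%:R * (num_arrangements k n)%:R + (k%:R - 1) ^+ n.+1 :> rat.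
  have /(congr1 (intr : int -> rat)) := num_arrangementsS k n.
  by rewrite rmorphD rmorphM rmorphXn rmorphB rmorph1 /= -!pmulrn.
have n0 : n.+1%:R != 0 :> rat by rewrite Num.Theory.pnatr_eq0.
have coefB (f g : fps rat) m :
  fps_coef (f - g) m = fps_coef f m - fps_coef g m by [].
have egfE a m : fps_coef (egf a) m = a m / m`!%:R by [].
(* In degree [n.+1] the claim is the recurrence divided by (n + 1)!. *)
rewrite coefB mulX !egfE [RHS]/((k%:R - 1) ^+ n.+1 / n.+1`!%:R) aS.
by rewrite factS natrM mulrDl -mulf_div divff // mul1r addrAC subrr add0r.
Qed.

Lemma num_arrangements_binomial (k n : nat) :
  num_arrangements k.+1 n =
  (\sum_(i < n.+1) 'C(n, i) * num_arrangements k i)%N.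
Proof.
elim: n => [|n IHn]; first by rewrite big_ord1 !num_arrangements0.
have [] : (num_arrangements k.+1 n.+1)%:Z =
  (\sum_(i < n.+2) 'C(n.+1, i) * num_arrangements k i)%N%:Z; last by [].
have kS : k.+1%:Z - 1 = k%:Z by rewrite -addn1 PoszD addrK.
rewrite num_arrangementsS IHn kS -[(\sum_(i < n.+1) _)%N%:Z]natz.
rewrite -[(\sum_(i < n.+2) _)%N%:Z]natz !natr_sum mulr_sumr.
(* The inhomogeneous term is expanded as a power of (k - 1) + 1, to be matched with the recurrences
   of the summands. *)
have -> : k%:Z ^+ n.+1 = \sum_(i < n.+2) 'C(n.+1, i)%:R * (k%:Z - 1) ^+ i.
  rewrite -[k%:Z in LHS](subrK 1) addrC exprDn.
  by apply: eq_bigr => i _; rewrite expr1n mul1r mulr_natl.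
(* The terms of index 0 are both 1; the others agree by the recurrence at [i.+1] and the absorption
   identity [mul_bin_diag]. *)
rewrite [X in _ + X]big_ord_recl [RHS]big_ord_recl num_arrangements0 addrCA.
congr (_ + _).
rewrite -big_split; apply: eq_bigr => i _ /=.
rewrite /bump add1n !natrM !natz num_arrangementsS mulrDr; congr (_ + _).
by rewrite !mulrA -!PoszM (mul_bin_diag n.+1 i) (mulnC i.+1).
Qed.

Theorem proposition2 (k : nat) :
  (num_arrangements k 0 = 1%N /\
   forall n : nat, (0 < n)%N ->
     (num_arrangements k n)%:Z =
       n%:Z * (num_arrangements k n.-1)%:Z + (k%:Z - 1) ^+ n) /\
  egf (fun n => (num_arrangements k n)%:R) = fps_exp (k%:R - 1) / (1 - fpsX) /\
  (forall n : nat,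
     (num_arrangements k n)%:Z =
       permanent (\matrix_(i < n, j < n) (if i == j then k%:Z else 1))) /\
  ((0 < k)%N -> forall n : nat,
     num_arrangements k n =
       (\sum_(i < n.+1) 'C(n, i) * num_arrangements k.-1 i)%N).
Proof.
split; [split; first exact: num_arrangements0 | split; last split].
- by case=> // n _; apply: num_arrangementsS.
- exact: egf_num_arrangements.
- exact: num_arrangements_permanent.
- by case: k => // k _ n; apply: num_arrangements_binomial.
Qed.
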